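(* Let $d,\gamma\in\mathbb{N}$ with $d\ge1$ and $\gamma>1$ be fixed, and for every $n\ge d$ let nodes $a=x_0<x_1<\dots<x_n=b$ (depending on $n$) be given. In the case of equidistant nodes (i.e. $h=h^*$) and, more generally, in the case of quasi-equidistant nodes (i.e. $h/h^*\le\rho$ with $\rho\in\mathbb{R}$ independent of $n$), the Lebesgue constants of generalized Floater--Hormann interpolation satisfy $$\sup_n\Lambda_n<\infty.$$
   Context: $\mathbb{N}=\{1,2,3,\ldots\}$. For nodes $a=x_0<x_1<\dots<x_n=b$ let $h=\max_{0\le k<n}(x_{k+1}-x_k)$ and $h^*=\min_{0\le k<n}(x_{k+1}-x_k)$. For $1\le d\le n$ and $\gamma\in\mathbb{N}$ let $$\tilde\lambda_i(x)=(-1)^{i\gamma}\prod_{s=i}^{i+d}\frac1{(x-x_s)^\gamma}\ (0\le i\le n-d),\qquad D(x)=\sum_{i=0}^{n-d}\tilde\lambda_i(x),$$ $$J_k=\{i\in\{0,\ldots,n-d\}:k-d\le i\le k\},\qquad w_k(x)=\sum_{i\in J_k}(-1)^{i\gamma}\prod_{s=i,\,s\ne k}^{i+d}\frac{1}{(x_k-x_s)(x-x_s)^{\gamma-1}}.$$ For $k=0,\ldots,n$ define $b_k(x)=\dfrac{w_k(x)}{(x-x_k)^\gamma D(x)}$ if $x\notin\{x_0,\ldots,x_n\}$, $b_k(x_k)=1$, and $b_k(x_j)=0$ for $j\neq k$. The generalized Floater--Hormann interpolant of $f$ is $\tilde r(f,x)=\sum_{k=0}^n f(x_k)b_k(x)$;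 its Lebesgue function is $\Lambda_n(x)=\sum_{k=0}^n|b_k(x)|$ and its Lebesgue constant is $\Lambda_n=\sup_{x\in[a,b]}\Lambda_n(x)$. ($D(x)\neq0$ for every real $x$ that is not a node.) *)

(* Defs.v *)
From mathcomp Require Import all_boot all_order all_algebra.
From mathcomp Require Import all_classical all_reals all_analysis.

Set Implicit Arguments.
Unset Strict Implicit.
Unset Printing Implicit Defensive.

Import Order.TTheory GRing.Theory Num.Theory.
Local Open Scope classical_set_scope.
Local Open Scope ring_scope.

(* Throughout, the nodes x_0, ..., x_n are the values [X 0], ..., [X n] of     *)
(* [X : nat -> R]; values of [X] beyond [n] are never used when 1 <= d <= n.  *)

Definition is_nodes (R : realType) (a b : R) (n : nat) (X : nat -> R) : Prop :=
  [/\ X 0%N = a, X n = b & forall k, (k < n)%N -> X k < X k.+1].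

(* The default value [X 1 - X 0] of the two big operators is one of the gaps  *)
(* as soon as 1 <= n, so these are the maximum and the minimum of the gaps.   *)
Definition mesh_max (R : realType) (n : nat) (X : nat -> R) : R :=
  \big[Num.max/(X 1%N - X 0%N)]_(0 <= k < n) (X k.+1 - X k).

Definition mesh_min (R : realType) (n : nat) (X : nat -> R) : R :=
  \big[Num.min/(X 1%N - X 0%N)]_(0 <= k < n) (X k.+1 - X k).

Definition lambda_tilde (R : realType) (d gam : nat) (X : nat -> R)
    (i : nat) (x : R) : R :=
  (-1) ^+ (i * gam) * \prod_(i <= s < (i + d).+1) (1 / (x - X s) ^+ gam).

Definition FH_den (R : realType) (n d gam : nat) (X : nat -> R) (x : R) : R :=
  \sum_(0 <= i < (n - d).+1) lambda_tilde d gam X i x.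

(* The truncated subtraction in [k - d <= i] is harmless since 0 <= i.        *)
Definition FH_weight (R : realType) (n d gam : nat) (X : nat -> R)
    (k : nat) (x : R) : R :=
  \sum_(0 <= i < (n - d).+1 | (k - d <= i <= k)%N)
    (-1) ^+ (i * gam) *
    \prod_(i <= s < (i + d).+1 | s != k)
      (1 / ((X k - X s) * (x - X s) ^+ (gam - 1))).

Definition FH_basis (R : realType) (n d gam : nat) (X : nat -> R)
    (k : nat) (x : R) : R :=
  if x == X k then 1
  else if [exists j : 'I_n.+1, x == X j] then 0
  else FH_weight n d gam X k x / ((x - X k) ^+ gam * FH_den n d gam X x).

Definition lebesgue_function (R : realType) (n d gam : nat) (X : nat -> R)
    (x : R) : R :=
  \sum_(0 <= k < n.+1) `|FH_basis n d gam X k x|.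

(* The supremum is taken in the extended reals, so that it is [+oo] when the  *)
(* Lebesgue function is unbounded on [a, b].                                  *)
Definition lebesgue_constant (R : realType) (a b : R) (n d gam : nat)
    (X : nat -> R) : \bar R :=
  ereal_sup [set (lebesgue_function n d gam X x)%:E | x in `[a, b]].

(* Main.v *)
Require Import Defs.
From mathcomp Require Import all_boot all_order all_algebra.
From mathcomp Require Import all_classical all_reals all_analysis.
From mathcomp Require Import zify ring lra.

Set Implicit Arguments.
Unset Strict Implicit.
Unset Printing Implicit Defensive.

Import Order.TTheory GRing.Theory Num.Theory.
Local Open Scope classical_set_scope.
Local Open Scope ring_scope.

(* Let [x] lie in the gap between [X m] and [X m.+1], let [H] bound the gaps from
   above and let [P] be the product of the distances from [x] to these two nodes,
   divided by [H ^+ 2].  The terms of the denominator whose nodes straddle the gap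
   have a common sign, and the two alternating tails agree with it, so [FH_den] is
   at least a constant times [(H ^+ d.+1 * P) ^- gam].  Up to constants
   depending on [rho] (this is where quasi-equidistance enters), [`|x - X s|] is
   [H * (1 + |s - m|)], except that for [s = m] and [s = m.+1] it carries the small
   factors that make up [P].  All powers of [H] and [P] cancel
   in the quotient, which leaves [|b_k(x)| <= C * (1 + |k - m|) ^- gam]; this is
   summable uniformly in [n] and [m] because [1 < gam]. *)

(** * Products, alternating sums and a summable sequence of offsets *)

Lemma ler_prod_nat (R : numDomainType) (p q : nat) (P : pred nat) (E F : nat -> R) :
  (forall s, (p <= s < q)%N -> P s -> 0 <= E s <= F s) ->
  \prod_(p <= s < q | P s) E s <= \prod_(p <= s < q | P s) F s.
Proof.
move=> h; rewrite big_nat_cond [leRHS]big_nat_cond.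
by apply: ler_prod => s /andP[]; exact: h.
Qed.

Lemma prod_spike (R : comNzRingType) (p q m : nat) (v : R) :
  \prod_(p <= s < q) (if s == m then v else 1) =
  if (p <= m < q)%N then v else 1.
Proof. by rewrite -big_mkcond big_nat1_eq. Qed.

(** By induction the signed partial sum stays between 0 and its last term: each new term dominates
    the previous one, so subtracting the old partial sum from it leaves a value in the new range. *)
Lemma alternating_sum_nondecr (R : realDomainType) (a : nat -> R) (p : nat) :
  (forall i, (i < p)%N -> 0 <= a i) ->
  (forall i, (i.+1 < p)%N -> a i <= a i.+1) ->
  0 <= (-1) ^+ p.+1 * \sum_(0 <= i < p) (-1) ^+ i * a i.
Proof.
move=> a0 amono.
suff H q : (q <= p)%N ->
    0 <= (-1) ^+ q.+1 * \sum_(0 <= i < q) (-1) ^+ i * a i <=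
      (if q is q'.+1 then a q' else 0).
  by have /andP[] := H p (leqnn p).
elim: q => [_|q IH qp]; first by rewrite big_nil mulr0 lexx.
have := IH (ltnW qp); rewrite big_nat_recr //= !exprS !mulN1r !mulNr opprK.
rewrite mulrDr mulrA -expr2 sqrr_sign mul1r.
move: (_ ^+ q * _) => T /andP[T0 Tle].
have a_le : (if q is q'.+1 then a q' else 0) <= a q.
  by case: q qp {IH T0 Tle} => [|q] qp; [exact: a0 | exact: amono].
by rewrite gerDr -oppr_ge0 T0 andbT -lerBlDl sub0r (le_trans Tle).
Qed.

(** Summing backwards reduces this to the nondecreasing case. *)
Lemma alternating_sum_nonincr (R : realDomainType) (a : nat -> R) (q N : nat) :
  (q <= N)%N ->
  (forall i, (q <= i < N)%N -> 0 <= a i) ->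
  (forall i, (q <= i)%N -> (i.+1 < N)%N -> a i.+1 <= a i) ->
  0 <= (-1) ^+ q * \sum_(q <= i < N) (-1) ^+ i * a i.
Proof.
move=> qN a0 amono; set l := (N - q)%N.
pose b j := a (q + (l - j.+1))%N.
have : 0 <= (-1) ^+ l.+1 * \sum_(0 <= j < l) (-1) ^+ j * b j.
  apply: alternating_sum_nondecr => j jl; rewrite /b.
    by apply: a0; lia.
  have -> : (q + (l - j.+1) = (q + (l - j.+2)).+1)%N by lia.
  by apply: amono; lia.
congr (0 <= _); rewrite -[in RHS](add0n q) big_addn -/l add0n.
rewrite [in RHS]big_nat_rev /= add0n !big_distrr /=.
apply: eq_big_nat => j /andP[_ jl].
rewrite /b [(q + (_ - _))%N]addnC !mulrA -!exprD; congr (_ * _).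
rewrite -[LHS]signr_odd -[RHS]signr_odd; congr (_ ^+ _); lia.
Qed.

(** This is [1 + |s - m|]: with truncated subtraction one of the two differences vanishes. The
    successor keeps it invertible. *)
Definition offset (m s : nat) : nat := ((s - m) + (m - s)).+1.

Lemma sum_inv_offset_sq (R : realFieldType) (m n : nat) :
  \sum_(0 <= k < n) ((offset m k)%:R ^+ 2)^-1 <= 3 :> R.
Proof.
(* A telescoping potential with values in [0, 3] whose increments dominate the summands:
   [1/((t+1)(t+2))] against [1/(t+2)^2] before [m], and [2/((t+1)(t+2))] against [1/(t+1)^2] from
   [m] on. The 2 is forced at [k = m], where the summand is 1. *)
pose phi k : R := if (k < m)%N then (m - k).+1%:R^-1 else 3 - 2 / (k - m).+1%:R.
have phi_bd k : 0 <= phi k <= 3.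
  rewrite /phi; case: ifP => _.
    rewrite invr_ge0 ler0n /= (le_trans (y := 1)) ?ler1n //.
    by rewrite invf_le1 ?ltr0n // ler1n.
  have h : 0 < (k - m).+1%:R^-1 :> R by rewrite invr_gt0 ltr0Sn.
  have h' : (k - m).+1%:R^-1 <= 1 :> R by rewrite invf_le1 ?ltr0Sn // ler1n.
  by move: (_^-1) h h' => t t0 t1; apply/andP; split; lra.
apply: (@le_trans _ _ (\sum_(0 <= k < n) (phi k.+1 - phi k))); last first.
  rewrite telescope_sumr //.
  by have /andP[_ ?] := phi_bd n; have /andP[? _] := phi_bd 0%N; lra.
apply: ler_sum => k _; rewrite /phi /offset.
have [km|mk] := ltnP k m.
- have -> : ((k - m + (m - k)) = (m - k.+1).+1)%N by lia.
  have -> : ((m - k) = (m - k.+1).+1)%N by lia.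
  set j := (m - k.+1)%N.
  have [|h] := ltnP k.+1 m.
    move=> _; rewrite -[j.+2%:R]natr1 -[j.+1%:R]natr1.
    have : 0 <= j%:R :> R by [].
    move: j%:R => t t0.
    rewrite -subr_ge0 (_ : _ - _ = ((t + 1) * (t + 1 + 1) ^+ 2)^-1); last by field; lra.
    by rewrite invr_ge0; nra.
  have -> : j = 0%N by rewrite /j; lia.
  have -> : (k.+1 - m = 0)%N by lia.
  by lra.
- have -> : ((k - m + (m - k)) = k - m)%N by lia.
  rewrite ltnNge (leqW mk) /= subSn //.
  set j := (k - m)%N; rewrite -[j.+2%:R]natr1 -[j.+1%:R]natr1.
  have : 0 <= j%:R :> R by [].
  move: j%:R => t t0.
  rewrite -subr_ge0 (_ : _ - _ = t * ((t + 1) ^+ 2 * (t + 1 + 1))^-1); last by field; lra.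
  by rewrite mulr_ge0 // invr_ge0; nra.
Qed.

(* The factors [u] and [v] stand for the relative distances from [x] to the two
   endpoints of its gap, the only distances with no positive lower bound. *)
Definition gap_factor (R : realType) (u v : R) (m s : nat) : R :=
  (if s == m then u else 1) * (if s == m.+1 then v else 1).

Lemma prod_gap_factor (R : realType) (u v : R) (m p q : nat) :
  \prod_(p <= s < q) gap_factor u v m s =
  (if (p <= m < q)%N then u else 1) * (if (p <= m.+1 < q)%N then v else 1).
Proof. by rewrite big_split /= !prod_spike. Qed.

(** * Quasi-uniform nodes *)

Definition quasi_uniform (R : realType) (n : nat) (X : nat -> R) (eta rho : R) :=
  forall k, (k < n)%N -> eta <= X k.+1 - X k <= rho * eta.

Lemma quasi_uniform_dist (R : realType) n (X : nat -> R) eta rho i j :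
  quasi_uniform n X eta rho -> (i <= j)%N -> (j <= n)%N ->
  (j - i)%:R * eta <= X j - X i <= (j - i)%:R * (rho * eta).
Proof.
move=> hX; elim: j => [|j IH].
  by rewrite leqn0 => /eqP -> _; rewrite subrr !mul0r lexx.
rewrite leq_eqVlt => /predU1P[->|ij] jn; first by rewrite subnn subrr !mul0r lexx.
have /andP[h1 h2] := IH ij (ltnW jn).
have /andP[h3 h4] := hX _ jn.
rewrite subSn // -natr1 !mulrDl !mul1r; lra.
Qed.

Lemma nodes_lt (R : realType) n (X : nat -> R) eta rho i j :
  0 < eta -> quasi_uniform n X eta rho -> (i < j)%N -> (j <= n)%N -> X i < X j.
Proof.
move=> eta0 hX ij jn.
have /andP[h _] := quasi_uniform_dist hX (ltnW ij) jn.
rewrite -subr_gt0 (lt_le_trans _ h) // mulr_gt0 // ltr0n subn_gt0 //.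
Qed.

Lemma nodes_le (R : realType) n (X : nat -> R) eta rho i j :
  0 < eta -> quasi_uniform n X eta rho -> (i <= j)%N -> (j <= n)%N -> X i <= X j.
Proof.
move=> eta0 hX; rewrite leq_eqVlt => /predU1P[->//|ij] jn.
exact/ltW/(nodes_lt eta0 hX).
Qed.

(** * Signs and sizes of the terms of the denominator, and its lower bound *)

Definition lambda_abs (R : realType) (d gam : nat) (X : nat -> R) (x : R) (i : nat) : R :=
  \prod_(i <= s < (i + d).+1) (`|x - X s| ^+ gam)^-1.

(** For [x] between [X m] and [X m.+1], the factor [(-1) ^+ (m < s)] is the sign of [x - X s]. The
    cases are the windows ending at or before [m], containing [m], and starting after [m]. *)
Lemma prod_sign (R : comNzRingType) (d m i : nat) :
  [/\ (i + d <= m)%N -> \prod_(i <= s < (i + d).+1) (-1) ^+ (m < s)%N = 1 :> R,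
      (i <= m <= i + d)%N ->
        \prod_(i <= s < (i + d).+1) (-1) ^+ (m < s)%N = (-1) ^+ (i + d - m) :> R
    & (m < i)%N -> \prod_(i <= s < (i + d).+1) (-1) ^+ (m < s)%N = (-1) ^+ d.+1 :> R].
Proof.
have lo p q : (q <= m.+1)%N -> \prod_(p <= s < q) (-1) ^+ (m < s)%N = 1 :> R.
  move=> qm; rewrite big_nat big1 // => s /andP[_ sq].
  by rewrite (_ : (m < s)%N = false) ?expr0 //; lia.
have hi p q : (m < p)%N -> \prod_(p <= s < q) (-1) ^+ (m < s)%N = (-1) ^+ (q - p) :> R.
  move=> mp; rewrite -prodr_const_nat; apply: eq_big_nat => s /andP[ps _].
  by rewrite (leq_trans mp ps) expr1.
split.
- by move=> h; exact: lo.
- move=> /andP[im mi]; rewrite (@big_cat_nat _ _ _ m.+1) ?(leqW im) //=.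
  rewrite (lo i m.+1) ?(hi m.+1) // mul1r.
  by congr (_ ^+ _); lia.
- by move=> mi; rewrite hi //; congr (_ ^+ _); lia.
Qed.

Section Denominator.
Variables (R : realType) (n d gam : nat) (X : nat -> R) (x : R) (m : nat).
Hypotheses (d_gt0 : (0 < d)%N) (dn : (d <= n)%N) (mn : (m < n)%N).
Hypothesis X_mono : forall i j, (i <= j)%N -> (j <= n)%N -> X i <= X j.
Hypothesis x_gap : X m < x < X m.+1.

Lemma left_of_gap s : (s <= m)%N -> X s < x.
Proof.
move=> sm; have /andP[h _] := x_gap; apply: le_lt_trans h.
by apply: X_mono => //; exact: ltnW.
Qed.

Lemma right_of_gap s : (m < s <= n)%N -> x < X s.
Proof.
by case/andP=> ms sn; have /andP[_ h] := x_gap; apply: (lt_le_trans h); exact: X_mono.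
Qed.

Lemma norm_gt0_of_gap s : (s <= n)%N -> 0 < `|x - X s|.
Proof.
move=> sn; rewrite normr_gt0 subr_eq0; have [sm|ms] := leqP s m.
  by rewrite gt_eqF // left_of_gap.
by rewrite lt_eqF // right_of_gap ?ms.
Qed.

Lemma lambda_abs_gt0 i : (i + d <= n)%N -> 0 < lambda_abs d gam X x i.
Proof.
move=> idn; rewrite /lambda_abs big_nat; apply: prodr_gt0 => s /andP[_ si].
by rewrite invr_gt0 exprn_gt0 // norm_gt0_of_gap //; lia.
Qed.

(** The whole sign is gathered under the power [gam], so that afterwards only the parity of [gam]
    matters. *)
Lemma lambda_tilde_sign i : (i + d <= n)%N ->
  lambda_tilde d gam X i x =
  ((-1) ^+ i * \prod_(i <= s < (i + d).+1) (-1) ^+ (m < s)%N) ^+ gam *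
  lambda_abs d gam X x i.
Proof.
move=> idn; rewrite /lambda_tilde exprM exprMn -mulrA; congr (_ * _).
rewrite -prodrXl -big_split /=; apply: eq_big_nat => s /andP[_ si].
have [sm|ms] := leqP s m.
  by rewrite expr0 expr1n !mul1r gtr0_norm // subr_gt0 left_of_gap.
rewrite expr1 ltr0_norm; last by rewrite subr_lt0 right_of_gap // ms; lia.
by rewrite -[- (x - _)]mulN1r exprMn invfM invr_sign mulrA -expr2 sqrr_sign.
Qed.

(** Consecutive windows share all nodes but the first of one and the last of the other, so comparing
    the products amounts to comparing these two distances. *)
Lemma lambda_absS i : ((i.+1 + d)%N <= n)%N ->
  (`|x - X (i + d.+1)| <= `|x - X i| ->
     lambda_abs d gam X x i <= lambda_abs d gam X x i.+1) /\
  (`|x - X i| <= `|x - X (i + d.+1)| ->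
     lambda_abs d gam X x i.+1 <= lambda_abs d gam X x i).
Proof.
move=> idn; rewrite /lambda_abs addSn.
rewrite [\prod_(i <= s < _) _]big_ltn; last by lia.
rewrite [\prod_(i.+1 <= s < _.+2) _]big_nat_recr /= -?addnS; last by lia.
rewrite [_^-1 * _]mulrC.
have B0 : 0 <= \prod_(i.+1 <= s < (i + d.+1)) (`|x - X s| ^+ gam)^-1.
  by apply: prodr_ge0 => s _; rewrite invr_ge0 exprn_ge0.
have p1 : 0 < `|x - X i| by rewrite norm_gt0_of_gap //; lia.
have p2 : 0 < `|x - X (i + d.+1)| by rewrite norm_gt0_of_gap //; lia.
by split => h; apply: ler_wpM2l => //; rewrite lef_pV2 ?posrE ?exprn_gt0 //;
  apply: lerXn2r; rewrite ?nnegrE.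
Qed.

Lemma lambda_abs_nondecr i : (i + d < m)%N ->
  lambda_abs d gam X x i <= lambda_abs d gam X x i.+1.
Proof.
move=> idm; apply: (lambda_absS _).1; first by lia.
rewrite !gtr0_norm ?subr_gt0 ?left_of_gap //; try lia.
by rewrite lerB // X_mono //; lia.
Qed.

Lemma lambda_abs_nonincr i : (m < i)%N -> (i.+1 + d <= n)%N ->
  lambda_abs d gam X x i.+1 <= lambda_abs d gam X x i.
Proof.
move=> mi idn; apply: (lambda_absS _).2; first by lia.
rewrite !ltr0_norm ?subr_lt0 ?right_of_gap //; try lia.
by rewrite lerN2 lerB // X_mono //; lia.
Qed.

Lemma ler_lambda_sum p q j : (p <= j < q)%N -> (q + d <= n.+1)%N ->
  lambda_abs d gam X x j <= \sum_(p <= i < q) lambda_abs d gam X x i.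
Proof.
move=> jpq qn; rewrite (@bigD1_seq _ _ _ _ _ j) /= ?iota_uniq ?mem_index_iota //.
rewrite lerDl big_nat_cond; apply: sumr_ge0 => i /andP[/andP[_ iq] _].
by apply/ltW/lambda_abs_gt0; lia.
Qed.

(* When [gam] is odd, the terms whose nodes straddle the gap containing [x]
   all have the sign [(-1) ^+ (d + m)]; on either side the terms alternate and
   decrease away from [x], so each side contributes with that same sign. *)
Lemma FH_den_ge j : (j <= m < j + d)%N -> (j + d <= n)%N ->
  lambda_abs d gam X x j <= `|FH_den n d gam X x|.
Proof.
move=> jm jdn; rewrite /FH_den.
have sign_pow i :
    ((-1) ^+ i * \prod_(i <= s < (i + d).+1) (-1) ^+ (m < s)%N) ^+ gam =
    if odd gam then (-1) ^+ i * \prod_(i <= s < (i + d).+1) (-1) ^+ (m < s)%N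
    else 1 :> R.
  rewrite prodrXr -exprD -exprM -[LHS]signr_odd oddM.
  by case: (odd gam); rewrite ?andbT ?andbF ?signr_odd.
have [godd|geven] := boolP (odd gam); last first.
  rewrite (@eq_big_nat _ _ _ _ _ _ (lambda_abs d gam X x)).
    by rewrite (le_trans _ (ler_norm _)) // ler_lambda_sum //; lia.
  move=> i /andP[_ ind]; rewrite lambda_tilde_sign; last by lia.
  by rewrite sign_pow (negbTE geven) mul1r.
(* The indices [p <= i < q] are those of the windows containing both [X m] and [X m.+1]. *)
set p := (m.+1 - d)%N; set q := minn m.+1 (n - d).+1.
have pjq : (p <= j < q)%N by rewrite /p /q; lia.
have qn : (q <= (n - d).+1)%N by rewrite /q; lia.
rewrite -[`|_|]mul1r -(normr_sign R (odd (d + m))) -normrM signr_odd.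
rewrite (le_trans _ (ler_norm _)) //.
rewrite (@big_cat_nat _ _ _ p) //=; last by lia.
rewrite (@big_cat_nat _ _ _ q p) //=; last by lia.
(* The last term on the left has index [m - d], hence sign [(-1) ^+ (m - d)], and it dominates its
   tail. *)
have left_ge0 : 0 <= (-1) ^+ (d + m) * \sum_(0 <= i < p) lambda_tilde d gam X i x.
  have [->|p0] := posnP p; first by rewrite big_nil mulr0.
  rewrite (@eq_big_nat _ _ _ _ _ _ (fun i => (-1) ^+ i * lambda_abs d gam X x i)).
    have -> : (-1) ^+ (d + m) = (-1) ^+ p.+1 :> R.
      by rewrite -[LHS]signr_odd -[RHS]signr_odd; congr (_ ^+ _); rewrite /p in p0 *; lia.
    apply: alternating_sum_nondecr => i ip; first by apply/ltW/lambda_abs_gt0; lia.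
    by apply: lambda_abs_nondecr; rewrite /p in ip; lia.
  move=> i /andP[_ ip]; have [h _ _] := prod_sign R d m i.
  rewrite lambda_tilde_sign; last by lia.
  by rewrite sign_pow godd h ?mulr1 //; rewrite /p in ip; lia.
(* The first term on the right has index [m.+1] and sign [(-1) ^+ (m.+1 + d.+1)]. This tail is empty
   unless [q = m.+1]. *)
have right_ge0 :
    0 <= (-1) ^+ (d + m) * \sum_(q <= i < (n - d).+1) lambda_tilde d gam X i x.
  have [Nq|qN] := leqP (n - d).+1 q; first by rewrite big_geq ?mulr0.
  have qE : q = m.+1 by rewrite /q in qN *; lia.
  rewrite (@eq_big_nat _ _ _ _ _ _
    (fun i => (-1) ^+ d.+1 * ((-1) ^+ i * lambda_abs d gam X x i))).
    rewrite -mulr_sumr mulrA -exprD.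
    have -> : (-1) ^+ (d + m + d.+1) = (-1) ^+ q :> R.
      by rewrite -[LHS]signr_odd -[RHS]signr_odd; congr (_ ^+ _); lia.
    apply: alternating_sum_nonincr => // i h; first by apply/ltW/lambda_abs_gt0; lia.
    by move=> h'; apply: lambda_abs_nonincr; lia.
  move=> i /andP[qi ip]; have [_ _ h] := prod_sign R d m i.
  rewrite lambda_tilde_sign; last by lia.
  by rewrite sign_pow godd h -?qE // mulrCA mulrA.
have mid_ge : lambda_abs d gam X x j <=
    (-1) ^+ (d + m) * \sum_(p <= i < q) lambda_tilde d gam X i x.
  rewrite mulr_sumr (@eq_big_nat _ _ _ _ _ _ (lambda_abs d gam X x)).
    by rewrite ler_lambda_sum //; lia.
  move=> i /andP[pi iq]; have [_ h _] := prod_sign R d m i.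
  rewrite lambda_tilde_sign; last by lia.
  rewrite sign_pow godd h; last by rewrite /p /q in pi iq; lia.
  rewrite mulrA -!exprD -signr_odd.
  by rewrite (_ : odd _ = false) ?mul1r //; rewrite /p /q in pi iq; lia.
rewrite !mulrDr; move: left_ge0 right_ge0 mid_ge.
by move: (_ * _) (_ * _) (_ * _) => s1 s2 s3; lra.
Qed.

End Denominator.

Ltac nat_lia :=
  repeat match goal with
  | H : ?T |- _ => match type of T with Prop =>
      lazymatch T with
      | is_true (leq _ _) => fail
      | is_true (leq _ _ && leq _ _) => fail
      | is_true (@eq_op nat _ _) => fail
      | is_true (~~ _) => fail
      | @eq nat _ _ => fail
      | _ => clear H
      end end
  end; lia.

(** A window holds at most [d.+1] indices. The range is first enlarged beyond [k], so that the
    condition alone delimits the sum. *)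
Lemma sum_window_const (R : numDomainType) (N d k : nat) (c : R) : 0 <= c ->
  \sum_(0 <= i < N | (k - d <= i <= k)%N) c <= d.+1%:R * c.
Proof.
move=> c0.
apply: (@le_trans _ _ (\sum_(0 <= i < N + k.+1 | (k - d <= i <= k)%N) c)).
  by rewrite (@big_cat_nat _ _ _ N 0 (N + k.+1)) ?leq_addr //= lerDl sumr_ge0.
have -> : \sum_(0 <= i < N + k.+1 | (k - d <= i <= k)%N) c =
    \sum_(k - d <= i < k.+1) c.
  rewrite (big_nat_widenl (k - d) 0) // (big_nat_widen 0 k.+1 (N + k.+1)) ?leq_addl //.
by rewrite sumr_const_nat -[leLHS]mulr_natl ler_wpM2r // ler_nat; nat_lia.
Qed.

(** Here [g] is [gam - 1]. The first factor comes from the lower bound on the denominator, the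
    powers of 3 from the constant [eta / 3] in the lower bounds on distances. *)
Definition basis_bound (R : realType) (rho : R) (d g : nat) : R :=
  ((rho * d.+1%:R) ^+ d.+1) ^+ g.+1 * ((3 ^+ d.+1) ^+ g * 3).

(** Both sides have degree [-(d.+1 * g.+1)] in [eta] and [-g.+1] in [P] and in [al]. This is the
    cancellation that makes the final bound independent of the mesh. *)
Lemma basis_bound_homogeneous (R : realType) (eta rho P al : R) (d g : nat) :
  0 < eta -> 0 < rho -> 0 < P -> 0 < al ->
  (eta ^+ d)^-1 * (((eta / 3) ^+ d.+1 * P * al) ^+ g)^-1 * (eta / 3 * P * al)^-1 =
  basis_bound rho d g * (al ^+ g.+1)^-1 *
    (((rho * eta * d.+1%:R) ^+ d.+1 * P) ^+ g.+1)^-1.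
Proof.
move=> /lt0r_neq0 e0 /lt0r_neq0 r0 /lt0r_neq0 P0 /lt0r_neq0 a0.
rewrite /basis_bound [rho * eta * _]mulrAC [(rho * _ * eta) ^+ _]exprMn.
rewrite expr_div_n [eta ^+ d.+1]exprSr.
have : eta ^+ d != 0 by rewrite expf_neq0.
have : 3 ^+ d.+1 != 0 :> R by rewrite expf_neq0 // pnatr_eq0.
have : (rho * d.+1%:R) ^+ d.+1 != 0 by rewrite expf_neq0 // mulf_neq0 // pnatr_eq0.
move: (_ ^+ d.+1) (3 ^+ d.+1) (eta ^+ d) => K Q E K0 Q0 E0.
rewrite !exprS !exprMn exprVn.
have := (expf_neq0 g K0, expf_neq0 g Q0, expf_neq0 g E0, expf_neq0 g e0,
  expf_neq0 g P0, expf_neq0 g a0).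
(* With every power turned into a variable, a rational identity remains. *)
move: (K ^+ g) (Q ^+ g) (E ^+ g) (eta ^+ g) (P ^+ g) (al ^+ g).
move=> Kg Qg Eg eg Pg ag [[[[[? ?] ?] ?] ?] ?].
by field; do ?[apply/andP; split].
Qed.

(** * Estimates for [x] strictly inside one gap *)

Section Estimates.
Variables (R : realType) (n d : nat) (X : nat -> R) (eta rho x : R) (m : nat).
Hypotheses (eta_gt0 : 0 < eta) (rho_ge1 : 1 <= rho).
Hypothesis X_qu : quasi_uniform n X eta rho.
Hypotheses (mn : (m < n)%N) (x_gap : X m < x < X m.+1).

Let X_mono i j : (i <= j)%N -> (j <= n)%N -> X i <= X j.
Proof. exact: nodes_le X_qu. Qed.

Let H := rho * eta.
Let u := `|x - X m| / H.
Let v := `|x - X m.+1| / H.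

Let H_gt0 : 0 < H.
Proof. by rewrite mulr_gt0 // (lt_le_trans ltr01). Qed.

Let uv01 : (0 < u <= 1) /\ (0 < v <= 1).
Proof.
have /andP[x1 x2] := x_gap; have /andP[_ gap] := X_qu mn.
rewrite /u /v gtr0_norm ?subr_gt0 // ltr0_norm ?subr_lt0 //.
rewrite !divr_gt0 ?subr_gt0 //=; last by lra.
by rewrite !ler_pdivrMr // !mul1r /H; split; lra.
Qed.

Lemma gap_factor_ge k : u * v <= gap_factor u v m k.
Proof.
have [/andP[u0 u1] /andP[v0 v1]] := uv01.
by rewrite /gap_factor; do 2 case: ifP => _; nra.
Qed.

(** Away from the gap, the distance is compared with the number of whole gaps between [x] and the
    node. The constant 3 is dictated by [s = m.+2], where the offset is 3 but only one whole gap is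
    guaranteed. *)
Lemma dist_bounds s : (s <= n)%N ->
  eta / 3 * gap_factor u v m s * (offset m s)%:R <= `|x - X s| <=
  H * gap_factor u v m s * (offset m s)%:R.
Proof.
move=> sn; have [/andP[u0 u1] /andP[v0 v1]] := uv01.
have /andP[x1 x2] := x_gap.
have [e0 H0] := (eta_gt0, H_gt0).
have etaH : eta <= H by rewrite /H ler_peMl // ltW.
have uE : `|x - X m| = H * u by rewrite /u mulrC divfK ?gt_eqF.
have vE : `|x - X m.+1| = H * v by rewrite /v mulrC divfK ?gt_eqF.
rewrite /gap_factor /offset.
have [sm|ms|->] := ltngtP s m.
- have -> : (s - m + (m - s)).+1 = (m - s).+1 by nat_lia.
  rewrite (_ : (s == m.+1) = false) ?mulr1; last by nat_lia.
  have /andP[l1 _] := quasi_uniform_dist X_qu (ltnW sm) (ltnW mn).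
  have /andP[_ l2] := quasi_uniform_dist X_qu (leqW (ltnW sm)) mn.
  rewrite subSn ?(ltnW sm) // -/H in l2.
  have t1 : 1 <= (m - s)%:R :> R by rewrite ler1n subn_gt0.
  rewrite gtr0_norm; last by rewrite subr_gt0 (le_lt_trans _ x1) // X_mono // ltnW.
  rewrite -[(m - s).+1%:R]natr1 in l2 *.
  have tl : eta <= (m - s)%:R * eta by rewrite ler_peMl // ltW.
  move: (m - s)%:R t1 l1 l2 tl => t t1 l1 l2 tl.
  by apply/andP; split; lra.
- have [->|sm1] := eqVneq s m.+1.
    rewrite mul1r vE.
    have -> : (m.+1 - m + (m - m.+1)).+1 = 2%N by nat_lia.
    by apply/andP; split; nra.
  rewrite mulr1.
  have -> : (s - m + (m - s)).+1 = (s - m.+1).+2 by nat_lia.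
  have /andP[l1 _] := quasi_uniform_dist X_qu ms sn.
  have /andP[_ l2] := quasi_uniform_dist X_qu (ltnW ms) sn.
  rewrite -/H (_ : (s - m = (s - m.+1).+1)%N) in l2; last by nat_lia.
  have t1 : 1 <= (s - m.+1)%:R :> R by rewrite ler1n; nat_lia.
  rewrite ltr0_norm; last by rewrite subr_lt0 (lt_le_trans x2) // X_mono.
  rewrite -[(s - m.+1).+1%:R]natr1 in l2.
  rewrite -[(s - m.+1).+2%:R]natr1 -[(s - m.+1).+1%:R]natr1.
  have tl : eta <= (s - m.+1)%:R * eta by rewrite ler_peMl // ltW.
  move: (s - m.+1)%:R t1 l1 l2 tl => t t1 l1 l2 tl.
  by apply/andP; split; nra.
- rewrite (_ : (m == m.+1) = false) ?mulr1; last by nat_lia.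
  rewrite subnn uE mulr1.
  by apply/andP; split; nra.
Qed.

(** A window containing both endpoints of the gap collects [u] and [v] once each, and its offsets
    are at most [d.+1]. *)
Lemma prod_dist_le j : (j <= m < j + d)%N -> (j + d <= n)%N ->
  \prod_(j <= s < (j + d).+1) `|x - X s| <= (H * d.+1%:R) ^+ d.+1 * (u * v).
Proof.
move=> jm jdn; have [/andP[u0 u1] /andP[v0 v1]] := uv01.
have -> : u * v = \prod_(j <= s < (j + d).+1) gap_factor u v m s.
  by rewrite prod_gap_factor !ifT //; nat_lia.
have -> : (H * d.+1%:R) ^+ d.+1 = \prod_(j <= s < (j + d).+1) (H * d.+1%:R).
  by rewrite prodr_const_nat; congr (_ ^+ _); nat_lia.
rewrite -big_split /=; apply: ler_prod_nat => s /andP[js sj] _.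
rewrite normr_ge0 /=; have /andP[_ h] := @dist_bounds s ltac:(nat_lia).
rewrite (le_trans h) // mulrAC ler_pM2r.
  by rewrite ler_pM2l // ler_nat /offset; nat_lia.
by rewrite (lt_le_trans _ (gap_factor_ge s)) // mulr_gt0.
Qed.

(** Any window collects each of [u] and [v] at most once, and both are at most 1. Of the offsets
    only that of [k] is kept, the others being at least 1; it supplies the decay in [k]. *)
Lemma prod_dist_ge i k : (i <= k <= i + d)%N -> (i + d <= n)%N ->
  (eta / 3) ^+ d.+1 * (u * v) * (offset m k)%:R <=
  \prod_(i <= s < (i + d).+1) `|x - X s|.
Proof.
move=> ik idn; have [/andP[u0 u1] /andP[v0 v1]] := uv01.
have e3 : 0 < eta / 3 by rewrite divr_gt0.
pose g s := eta / 3 * gap_factor u v m s * (offset m s)%:R.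
have g_gt0 s : 0 < gap_factor u v m s.
  by rewrite (lt_le_trans _ (gap_factor_ge s)) // mulr_gt0.
apply: (@le_trans _ _ (\prod_(i <= s < (i + d).+1) g s)); last first.
  apply: ler_prod_nat => s /andP[js sj] _.
  have /andP[h _] := @dist_bounds s ltac:(nat_lia).
  by rewrite h andbT /g mulr_ge0 // mulr_ge0 // ltW // g_gt0.
rewrite /g big_split big_split /= prodr_const_nat (_ : (_ - i = d.+1)%N); last by nat_lia.
apply: ler_pM => //.
- by apply: mulr_ge0; [exact/exprn_ge0/ltW | exact/ltW/mulr_gt0].
- rewrite ler_pM2l ?exprn_gt0 // prod_gap_factor.
  by do 2 case: ifP => _; nra.
- have kI : k \in index_iota i (i + d).+1 by rewrite mem_index_iota; nat_lia.
  rewrite (@bigD1_seq _ _ _ _ _ k) /= ?iota_uniq //.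
  rewrite ler_peMr //.
  rewrite -natr_prod ler1n prodn_cond_gt0 //.
Qed.

Let norm_gt0 s : (s <= n)%N -> 0 < `|x - X s|.
Proof. exact: (norm_gt0_of_gap mn X_mono x_gap). Qed.

Lemma FH_den_lower gam : (0 < d <= n)%N ->
  (((H * d.+1%:R) ^+ d.+1 * (u * v)) ^+ gam)^-1 <= `|FH_den n d gam X x|.
Proof.
(* The cap [n - d] keeps the window within the nodes; the window still straddles the gap because
   [m < n]. *)
move=> /andP[d0 dn]; pose j := minn m (n - d).
have jm : (j <= m < j + d)%N by rewrite /j; move: mn; nat_lia.
have jdn : (j + d <= n)%N by rewrite /j; nat_lia.
apply: le_trans (FH_den_ge _ d0 dn mn X_mono x_gap jm jdn).
have e_gt0 : 0 < \prod_(j <= s < (j + d).+1) `|x - X s|.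
  by rewrite big_nat; apply: prodr_gt0 => s /andP[_ sj]; apply: norm_gt0; nat_lia.
have e_le := prod_dist_le jm jdn; have b_gt0 := lt_le_trans e_gt0 e_le.
rewrite /lambda_abs prodfV prodrXl lef_pV2 ?posrE ?exprn_gt0 //.
by apply: lerXn2r; rewrite ?nnegrE // ltW.
Qed.

Lemma node_dist_ge k s : (k <= n)%N -> (s <= n)%N -> s != k -> eta <= `|X k - X s|.
Proof.
have e0 := eta_gt0.
wlog ks : k s / (k < s)%N.
  move=> hw kn sn sk; have [ks|ks|ks] := ltngtP k s; last by rewrite ks eqxx in sk.
    exact: hw.
  by rewrite distrC; apply: hw => //; rewrite eq_sym.
move=> kn sn _; have /andP[h _] := quasi_uniform_dist X_qu (ltnW ks) sn.
rewrite distrC (le_trans _ (ler_norm _)) // (le_trans _ h) //.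
by rewrite ler_peMl ?(ltW e0) // ler1n subn_gt0.
Qed.

(** Each of the [d] node differences is at least [eta]. What remains is an equality: [g] of the
    [g.+1] powers of the distance to [X k] complete the product over the window. *)
Lemma weight_term_le i k g : (i <= k <= i + d)%N -> (i + d <= n)%N ->
  \prod_(i <= s < (i + d).+1 | s != k) `|1 / ((X k - X s) * (x - X s) ^+ g)| /
    `|x - X k| ^+ g.+1 <=
  (eta ^+ d)^-1 * ((\prod_(i <= s < (i + d).+1) `|x - X s|) ^+ g)^-1 *
    (`|x - X k|)^-1.
Proof.
move=> ik idn; have e0 := eta_gt0.
have ek : 0 < `|x - X k| by apply: norm_gt0; nat_lia.
have kI : k \in index_iota i (i + d).+1 by rewrite mem_index_iota; nat_lia.
pose G s := eta^-1 * (`|x - X s| ^+ g)^-1.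
have le1 : \prod_(i <= s < (i + d).+1 | s != k) `|1 / ((X k - X s) * (x - X s) ^+ g)| <=
    \prod_(i <= s < (i + d).+1 | s != k) G s.
  apply: ler_prod_nat => s /andP[js sj] sk.
  rewrite normr_ge0 /= mul1r normfV normrM normrX.
  rewrite invfM ler_wpM2r ?invr_ge0 ?exprn_ge0 //.
  have h : eta <= `|X k - X s| by apply: node_dist_ge => //; nat_lia.
  by rewrite lef_pV2 // posrE // (lt_le_trans _ h).
have GE : \prod_(i <= s < (i + d).+1) G s =
    (eta ^+ d.+1)^-1 * ((\prod_(i <= s < (i + d).+1) `|x - X s|) ^+ g)^-1.
  rewrite big_split /= prodr_const_nat (_ : (_ - i = d.+1)%N); last by nat_lia.
  by rewrite exprVn prodfV prodrXl.
have Gk : G k != 0 by rewrite mulf_neq0 ?invr_neq0 ?expf_neq0 ?gt_eqF.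
rewrite (@bigD1_seq _ _ _ _ _ k) /= ?iota_uniq // in GE.
have {}GE := canRL (mulKf Gk) GE.
rewrite ler_pdivrMr ?exprn_gt0 // (le_trans le1) // GE /G.
rewrite le_eqVlt; apply/orP; left; apply/eqP.
have := expf_neq0 d (lt0r_neq0 e0); have := lt0r_neq0 e0.
have := expf_neq0 g (lt0r_neq0 ek); have := lt0r_neq0 ek.
rewrite !exprS !invfM !invrK.
move: (_ ^+ g)^-1 => Bg.
move: (eta ^+ d) (`|x - X k| ^+ g) => E K.
by move=> *; field; do ?[apply/andP; split].
Qed.

(** The window product yields [g] powers of the offset and the remaining distance to [X k] one more;
    homogeneity then makes the lower bound of the denominator appear. *)
Lemma weight_term_ratio_le i k g : (0 < d <= n)%N ->
  (i <= k <= i + d)%N -> (i + d <= n)%N ->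
  \prod_(i <= s < (i + d).+1 | s != k) `|1 / ((X k - X s) * (x - X s) ^+ g)| /
    `|x - X k| ^+ g.+1 <=
  basis_bound rho d g * ((offset m k)%:R ^+ g.+1)^-1 * `|FH_den n d g.+1 X x|.
Proof.
move=> dn ik idn; have [/andP[u0 u1] /andP[v0 v1]] := uv01.
have rho0 : 0 < rho by rewrite (lt_le_trans ltr01).
have P0 : 0 < u * v by rewrite mulr_gt0.
have al0 : 0 < (offset m k)%:R :> R by rewrite ltr0n.
have e3 : 0 < eta / 3 by rewrite divr_gt0.
have b0 : 0 < basis_bound rho d g by rewrite !mulr_gt0 // !exprn_gt0 // mulr_gt0.
have lo1 : 0 < (eta / 3) ^+ d.+1 * (u * v) * (offset m k)%:R.
  exact: mulr_gt0 (mulr_gt0 (exprn_gt0 _ e3) P0) al0.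
have lo2 : 0 < eta / 3 * (u * v) * (offset m k)%:R.
  exact: mulr_gt0 (mulr_gt0 e3 P0) al0.
have ek_ge : eta / 3 * (u * v) * (offset m k)%:R <= `|x - X k|.
  have /andP[h _] := @dist_bounds k ltac:(nat_lia).
  by apply: le_trans h; rewrite ler_pM2r // ler_pM2l // gap_factor_ge.
have pr_ge := prod_dist_ge ik idn.
apply: le_trans (weight_term_le g ik idn) _.
apply: le_trans (ler_wpM2l _ (FH_den_lower g.+1 dn)); last first.
  by rewrite mulr_ge0 ?ltW // invr_gt0 exprn_gt0.
rewrite -basis_bound_homogeneous //.
apply: ler_pM.
- by rewrite mulr_ge0 // invr_ge0 exprn_ge0 ?prodr_ge0 // ltW.
- by rewrite invr_ge0.
- rewrite ler_pM2l ?invr_gt0 ?exprn_gt0 // lef_pV2 ?posrE ?exprn_gt0 //.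
    by apply: lerXn2r; rewrite ?nnegrE ?prodr_ge0 // ltW.
  exact: lt_le_trans pr_ge.
- by rewrite lef_pV2 ?posrE // (lt_le_trans lo2).
Qed.

(** The factor [d.+1] counts the windows containing [k]. Since [0 < g], the decay exponent [g.+1] is
    at least 2 and is relaxed to the summable exponent 2. *)
Lemma FH_basis_le k g : (0 < d <= n)%N -> (0 < g)%N -> (k <= n)%N ->
  `|FH_basis n d g.+1 X k x| <=
  d.+1%:R * basis_bound rho d g * ((offset m k)%:R ^+ 2)^-1.
Proof.
move=> dn g0 kn; rewrite /FH_basis.
have not_node s : (s <= n)%N -> (x == X s) = false.
  by move=> sn; apply/negbTE; rewrite -subr_eq0 -normr_gt0 norm_gt0.
rewrite not_node //; case: existsP => [[j]|_]; first by rewrite not_node // -ltnS.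
have D0 : 0 < `|FH_den n d g.+1 X x|.
  apply: lt_le_trans (FH_den_lower g.+1 dn); have [/andP[u0 _] /andP[v0 _]] := uv01.
  by rewrite invr_gt0 exprn_gt0 // mulr_gt0 ?(mulr_gt0 u0)
    ?exprn_gt0 ?(mulr_gt0 H_gt0) ?ltr0n.
have rho0 : 0 < rho by rewrite (lt_le_trans ltr01).
have b0 : 0 < basis_bound rho d g by rewrite !mulr_gt0 // !exprn_gt0 // mulr_gt0.
have al1 : 1 <= (offset m k)%:R :> R by rewrite ler1n.
have al0 := lt_le_trans ltr01 al1.
rewrite normf_div normrM normrX invfM mulrA ler_pdivrMr //.
set c := basis_bound rho d g * ((offset m k)%:R ^+ 2)^-1 * `|FH_den n d g.+1 X x|.
have c0 : 0 <= c by rewrite mulr_ge0 // mulr_ge0 ?invr_ge0 ?exprn_ge0 // ltW.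
have -> : d.+1%:R * basis_bound rho d g * ((offset m k)%:R ^+ 2)^-1 *
    `|FH_den n d g.+1 X x| = d.+1%:R * c by rewrite /c !mulrA.
apply: le_trans (sum_window_const (n - d).+1 d k c0).
apply: (@le_trans _ _ (\sum_(0 <= i < (n - d).+1 | (k - d <= i <= k)%N)
  (\prod_(i <= s < (i + d).+1 | s != k) `|1 / ((X k - X s) * (x - X s) ^+ g)| /
    `|x - X k| ^+ g.+1))).
  rewrite -mulr_suml ler_wpM2r ?invr_ge0 ?exprn_ge0 //.
  rewrite (le_trans (ler_norm_sum _ _ _)) // ler_sum // => i _.
  by rewrite normrM normrX normrN1 expr1n mul1r normr_prod subn1.
rewrite big_nat_cond [leRHS]big_nat_cond; apply: ler_sum => i /andP[/andP[_ ind] ik].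
apply: le_trans (weight_term_ratio_le g dn _ _) _; [nat_lia|nat_lia|].
rewrite /c ler_wpM2r // ler_wpM2l ?(ltW b0) // lef_pV2 ?posrE ?exprn_gt0 //.
by rewrite ler_weXn2l.
Qed.

Lemma lebesgue_function_gap_le g : (0 < d <= n)%N -> (0 < g)%N ->
  lebesgue_function n d g.+1 X x <= d.+1%:R * basis_bound rho d g * 3.
Proof.
move=> dn g0.
have rho0 : 0 < rho by rewrite (lt_le_trans ltr01).
have b0 : 0 < basis_bound rho d g by rewrite !mulr_gt0 // !exprn_gt0 // mulr_gt0.
apply: le_trans (ler_wpM2l _ (sum_inv_offset_sq R m n.+1)); last first.
  by rewrite mulr_ge0 // ltW.
rewrite mulr_sumr /lebesgue_function big_nat [leRHS]big_nat.
by apply: ler_sum => k /andP[_ kn]; exact: FH_basis_le.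
Qed.

End Estimates.

(** * From a single gap to the whole interval and to all [n] *)

Lemma exists_gap (R : realType) n (X : nat -> R) (x : R) :
  X 0%N <= x <= X n -> (forall k, (k <= n)%N -> x != X k) ->
  exists2 m, (m < n)%N & X m < x < X m.+1.
Proof.
move=> /andP[x0 xn] not_node.
have exP : exists k, (k <= n)%N && (X k < x).
  by exists 0%N; rewrite leq0n lt_neqAle x0 eq_sym not_node.
have ubP k : (k <= n)%N && (X k < x) -> (k <= n)%N by case/andP.
(* [m] is the last index whose node lies left of [x]. *)
case: (ex_maxnP exP ubP) => m /andP[mn xm] m_max.
have m_lt : (m < n)%N.
  by rewrite ltn_neqAle mn andbT; apply: contraTneq xm => ->; rewrite -leNgt.
exists m => //; rewrite xm lt_neqAle not_node //= leNgt.
by apply/negP => h; have := m_max m.+1; rewrite m_lt h ltnn => /(_ isT).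
Qed.

Lemma lebesgue_function_node (R : realType) n d gam (X : nat -> R) eta rho j :
  0 < eta -> quasi_uniform n X eta rho -> (j <= n)%N ->
  lebesgue_function n d gam X (X j) = 1.
Proof.
move=> eta0 hX jn; rewrite /lebesgue_function.
have jI : j \in index_iota 0 n.+1 by rewrite mem_index_iota.
rewrite (bigD1_seq j jI (iota_uniq _ _)) /= {1}/FH_basis eqxx normr1.
rewrite big_nat_cond big1 ?addr0 // => k /andP[/andP[_ kn] kj].
have -> : FH_basis n d gam X k (X j) = 0; last by rewrite normr0.
rewrite /FH_basis; have -> : (X j == X k) = false.
  move: kj; rewrite neq_ltn => /orP[kj|jk].
    by rewrite gt_eqF // (nodes_lt eta0 hX).
  by rewrite lt_eqF // (nodes_lt eta0 hX).
rewrite ifT //; apply/existsP; exists (Ordinal (n := n.+1) (m := j) jn) => /=.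
by rewrite eqxx.
Qed.

(** The summand 1 covers the case where [x] is a node. *)
Lemma lebesgue_function_le (R : realType) n d g (X : nat -> R) eta rho x :
  (0 < d <= n)%N -> (0 < g)%N ->
  0 < eta -> 1 <= rho -> quasi_uniform n X eta rho -> X 0%N <= x <= X n ->
  lebesgue_function n d g.+1 X x <= 1 + d.+1%:R * basis_bound rho d g * 3.
Proof.
move=> dn g0 eta0 rho1 hX xab.
have b0 : 0 <= d.+1%:R * basis_bound rho d g * 3.
  by rewrite /basis_bound !(mulr_ge0, exprn_ge0) // (le_trans ler01).
have [/existsP[[j /= jn] /eqP ->]|/existsPn not_node] :=
    boolP [exists j : 'I_n.+1, x == X j].
  by rewrite (lebesgue_function_node _ _ eta0 hX jn) lerDl.
have [|m mn xm] := exists_gap xab.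
  by move=> k kn; exact: (not_node (Ordinal (n := n.+1) (m := k) kn)).
rewrite (le_trans (lebesgue_function_gap_le eta0 rho1 hX mn xm dn g0)) //.
by rewrite lerDr.
Qed.

Lemma mesh_min_gt0 (R : realType) (a b : R) n (X : nat -> R) :
  (0 < n)%N -> is_nodes a b n X -> 0 < mesh_min n X.
Proof.
move=> n0 [_ _ hX]; rewrite /mesh_min big_nat; apply: lt_bigmin => [|k /andP[_ kn]].
  by rewrite subr_gt0 hX.
by rewrite subr_gt0 hX.
Qed.

(** The maximum with 1 supplies the condition [1 <= rho] of the gap estimates. *)
Lemma quasi_uniform_mesh (R : realType) (a b rho : R) n (X : nat -> R) :
  (0 < n)%N -> is_nodes a b n X -> mesh_max n X / mesh_min n X <= rho ->
  quasi_uniform n X (mesh_min n X) (Num.max rho 1).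
Proof.
move=> n0 hX hrho k kn; have eta0 := mesh_min_gt0 n0 hX.
have kI : k \in index_iota 0 n by rewrite mem_index_iota.
apply/andP; split; first exact: (@bigmin_inf_seq _ _ _ _ _ k).
apply: (@le_trans _ _ (mesh_max n X)); first exact: (@le_bigmax_seq _ _ _ _ _ k).
by rewrite -ler_pdivrMr // (le_trans hrho) // le_max lexx.
Qed.

Theorem corollary4p3 (R : realType) (a b : R) (d gam : nat)
    (hd : (1 <= d)%N) (hgam : (1 < gam)%N) (X : nat -> nat -> R)
    (hX : forall n : nat, (d <= n)%N -> is_nodes a b n (X n)) :
  ((forall n : nat, (d <= n)%N -> mesh_max n (X n) = mesh_min n (X n)) ->
   (ereal_sup [set lebesgue_constant a b n d gam (X n)
              | n in [set n : nat | (d <= n)%N]] < +oo)%E)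
  /\
  (forall rho : R,
   (forall n : nat, (d <= n)%N ->
      mesh_max n (X n) / mesh_min n (X n) <= rho) ->
   (ereal_sup [set lebesgue_constant a b n d gam (X n)
              | n in [set n : nat | (d <= n)%N]] < +oo)%E).
Proof.
have quasi_case (rho : R) :
    (forall n : nat, (d <= n)%N -> mesh_max n (X n) / mesh_min n (X n) <= rho) ->
    (ereal_sup [set lebesgue_constant a b n d gam (X n)
              | n in [set n : nat | (d <= n)%N]] < +oo)%E.
  move=> hrho; case: gam hgam => // g; rewrite ltnS => g0.
  (* This bound depends only on [d], [g] and [rho], so it passes through both suprema. *)
  apply: (@le_lt_trans _ _
    (1 + d.+1%:R * basis_bound (Num.max rho 1) d g * 3)%:E); last exact: ltry.
  apply: ge_ereal_sup => _ [n /= dn <-].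
  apply: ge_ereal_sup => _ [x xab <-]; rewrite lee_fin.
  have n0 : (0 < n)%N by exact: leq_trans hd dn.
  have [X0 Xn _] := hX n dn.
  apply: (@lebesgue_function_le _ _ _ _ _ (mesh_min n (X n))) => //.
  - by rewrite dn andbT.
  - exact: mesh_min_gt0 n0 (hX n dn).
  - by rewrite le_max lexx orbT.
  - exact: quasi_uniform_mesh n0 (hX n dn) (hrho n dn).
  - by move: xab; rewrite /= in_itv /= X0 Xn.
split=> [heq|]; last exact: quasi_case.
(* Equidistant nodes have mesh ratio 1. *)
apply: (quasi_case 1) => n dn; rewrite heq // divff // gt_eqF //.
by apply: mesh_min_gt0 (hX n dn); exact: leq_trans hd dn.
Qed.
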